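(* Let $\Sigma$ be an affine semigroup, $\Gamma$ a graded lattice, $g\in P(\Gamma)$ a polynomial, and $A_g=\mathrm{Diff}(\Gamma)/\mathrm{Ann}(g)$. Let $\varphi\colon\mathrm{Sh}_{\mathbb{Q}}(\Sigma)\to\mathbb{Q}A_g$ be a surjective $\mathbb{Q}$-algebra homomorphism and $f\colon\Sigma\to\mathbb{Q}$ a function. Then $\varphi$ descends to an isomorphism $\mathbb{Q}K_f\cong\mathbb{Q}A_g$ if and only if there exists an invertible element $\mathrm{td}\in(\mathbb{Q}A_g)^\times$ such that $$\chi_f(E)=\deg_g(\mathrm{td}\cdot\varphi(E))\qquad\text{for all }E\in\mathrm{Sh}(\Sigma).$$
   Context: An affine semigroup $\Sigma$ is, up to isomorphism, a finitely generated submonoid of some $\mathbb{N}^k$. $\mathrm{Sh}(\Sigma)=\mathbb{Z}[\Sigma]$ is the semigroup algebra with basis $T^u$, $u\in\Sigma$, acting on functions $h\colon\Sigma\to\mathbb{Q}$ by $(T^uh)(x)=h(x+u)$; $\mathrm{Sh}_{\mathbb{Q}}(\Sigma)=\mathbb{Q}\otimes\mathrm{Sh}(\Sigma)$. For $f\colon\Sigma\to\mathbb{Q}$, $\mathrm{Ann}(f)=\{E: E\cdot f=0\}$, $K_f=\mathrm{Sh}(\Sigma)/\mathrm{Ann}(f)$ and $\chi_f(E)=(E\cdot f)(0)$. A graded lattice $\Gamma=\Gamma_1\oplus\dots\oplus\Gamma_d$ is a finite-rank free abelian group with a grading by positive degrees; $P(\Gamma)\cong\mathbb{Q}[x_1,\dots,x_n]$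 is the ring of polynomial functions $\Gamma\to\mathbb{Q}$ with rational coefficients ($x_i$ dual to a homogeneous basis), and $\mathrm{Diff}(\Gamma)\cong\mathbb{Z}[\partial/\partial x_1,\dots,\partial/\partial x_n]$ acts on it by differentiation. $\mathrm{Ann}(g)=\{D\in \mathrm{Diff}(\Gamma):D\cdot g=0\}$ and $\deg_g([D])=(D\cdot g)(0)$, extended $\mathbb{Q}$-linearly to $\mathbb{Q}A_g$. $\mathbb{Q}R=\mathbb{Q}\otimes_{\mathbb{Z}}R$; note $\mathbb{Q}K_f=\mathrm{Sh}_{\mathbb{Q}}(\Sigma)/\mathrm{Ann}_{\mathrm{Sh}_{\mathbb{Q}}(\Sigma)}(f)$. ''$\varphi$ descends to an isomorphism'' means that $\varphi$ factors through $\mathbb{Q}K_f$ and the induced map is an isomorphism. *)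

(* Defs.v *)
From HB Require Import structures.
From mathcomp Require Import all_boot all_order all_algebra.
From mathcomp Require Import generic_quotient ring_quotient boolp finmap.
From mathcomp Require Import ssrcomplements monalg mpoly.

Set Implicit Arguments.
Unset Strict Implicit.
Unset Printing Implicit Defensive.

Import Order.TTheory GRing.Theory Num.Theory.

Local Open Scope ring_scope.
Local Open Scope quotient_scope.

(* The quotients of ring_quotient require 1 \notin I and yield nonzero rings. *)
(* Ann(f) and Ann(g) are the unit ideal when f = 0 or g = 0, so the quotients *)
(* below are pzRings, for which the zero ring is allowed.                     *)

Record ideal (R : comPzRingType) := Ideal {
  ideal_mem :> {pred R};
  ideal_zmod_closed : zmod_closed ideal_mem;
  ideal_mull : forall a u : R, u \in ideal_mem -> a * u \in ideal_mem
}.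

HB.instance Definition _ (R : comPzRingType) (I : ideal R) :=
  GRing.isZmodClosed.Build R (ideal_mem I) (ideal_zmod_closed I).

Definition ringQuot (R : comPzRingType) (I : ideal R) : Type :=
  Quotient.quot (ideal_mem I).

Section RingQuot.
Variables (R : comPzRingType) (I : ideal R).

Local Notation Q := (ringQuot I).

HB.instance Definition _ := Choice.on Q.
HB.instance Definition _ := EqQuotient.on Q.
HB.instance Definition _ := ZmodQuotient.on Q.

Definition proj (x : R) : Q := \pi_Q x.

Lemma proj_reprK (x : Q) : proj (repr x) = x.
Proof. exact: reprK. Qed.

Lemma projP (x y : R) : proj x = proj y <-> x - y \in ideal_mem I.
Proof.
rewrite (Quotient.idealrBE (ideal_mem I)).
by split => [/eqP|/eqP].
Qed.

Lemma proj_eq0 (x : R) : proj x = 0 <-> x \in ideal_mem I.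
Proof. by rewrite -{2}[x]subr0 -projP /proj /= raddf0. Qed.

Definition quot_one : Q := proj 1.
Definition quot_mul (x y : Q) : Q := proj (repr x * repr y).

Lemma proj_repr (x : R) : repr (proj x) - x \in ideal_mem I.
Proof. by apply/projP; rewrite proj_reprK. Qed.

Lemma projM (x y : R) : proj (x * y) = quot_mul (proj x) (proj y).
Proof.
apply/esym/projP.
set x' := repr _; set y' := repr _.
have -> : x' * y' - x * y = y' * (x' - x) + x * (y' - y).
  by rewrite !mulrBr addrA [y' * x']mulrC [y' * x]mulrC subrK.
by rewrite rpredD // ideal_mull // proj_repr.
Qed.

Fact quot_mulA : associative quot_mul.
Proof.
move=> x y z.
by rewrite -[x]proj_reprK -[y]proj_reprK -[z]proj_reprK -!projM mulrA.
Qed.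

Fact quot_mulC : commutative quot_mul.
Proof. by move=> x y; rewrite /quot_mul mulrC. Qed.

Fact quot_mul1 : left_id quot_one quot_mul.
Proof. by move=> x; rewrite -[x]proj_reprK -projM mul1r. Qed.

Fact proj_zmod_morphism : zmod_morphism proj.
Proof. exact: raddfB. Qed.

Fact quot_mulDl : left_distributive quot_mul +%R.
Proof.
move=> x y z; rewrite -[x]proj_reprK -[y]proj_reprK -[z]proj_reprK.
have projD a b : proj (a + b) = proj a + proj b by exact: raddfD.
by rewrite -projD -!projM mulrDl projD.
Qed.

HB.instance Definition _ := GRing.Zmodule_isComPzRing.Build Q
  quot_mulA quot_mulC quot_mul1 quot_mulDl.

HB.instance Definition _ := GRing.isZmodMorphism.Build R Q proj
  proj_zmod_morphism.

Fact proj_monoid_morphism : monoid_morphism proj.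
Proof. by split=> // x y; rewrite projM. Qed.

HB.instance Definition _ := GRing.isMonoidMorphism.Build R Q proj
  proj_monoid_morphism.

End RingQuot.

Section AlgQuot.
Variables (K : pzRingType) (A : comAlgType K) (I : ideal A).

Definition quot_scale (a : K) (x : ringQuot I) : ringQuot I :=
  proj I (a *: repr x).

Lemma projZ_def (a : K) (x : A) : proj I (a *: x) = quot_scale a (proj I x).
Proof.
apply/esym/projP; rewrite -scalerBr -mulr_algl.
by apply: ideal_mull; apply: proj_repr.
Qed.

Fact quot_scaleA a b x : quot_scale a (quot_scale b x) = quot_scale (a * b) x.
Proof. by rewrite -[x]proj_reprK -!projZ_def scalerA. Qed.

Fact quot_scale1 : left_id 1 quot_scale.
Proof. by move=> x; rewrite -[x]proj_reprK -projZ_def scale1r. Qed.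

Fact quot_scaleDr : right_distributive quot_scale +%R.
Proof.
move=> a x y; rewrite -[x]proj_reprK -[y]proj_reprK.
by rewrite -raddfD -!projZ_def scalerDr raddfD.
Qed.

Fact quot_scaleDl x : {morph quot_scale^~ x : a b / a + b}.
Proof.
by move=> a b; rewrite -[x]proj_reprK -!projZ_def scalerDl raddfD.
Qed.

HB.instance Definition _ := GRing.Zmodule_isLmodule.Build K (ringQuot I)
  quot_scaleA quot_scale1 quot_scaleDr quot_scaleDl.

Fact proj_scalable : scalable (proj I).
Proof. by move=> a x; rewrite projZ_def. Qed.

HB.instance Definition _ := GRing.isScalable.Build K A (ringQuot I) *:%R
  (proj I) proj_scalable.

Fact quot_scalerAl (a : K) (x y : ringQuot I) : a *: (x * y) = a *: x * y.
Proof.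
rewrite -[x]proj_reprK -[y]proj_reprK -rmorphM -!linearZ -rmorphM /=.
by rewrite scalerAl.
Qed.

End AlgQuot.

(* [is_rationalization iota] : V is the tensor product of rat and M over the  *)
(* integers, with q (x) m = q *: iota m (universal property).                 *)

Definition biadditive (U M W : zmodType) (beta : U -> M -> W) : Prop :=
  (forall m, zmod_morphism (beta^~ m)) /\ (forall q, zmod_morphism (beta q)).

Definition is_rationalization (M : zmodType) (V : lmodType rat)
    (iota : M -> V) : Prop :=
  biadditive (fun q m => q *: iota m) /\
  forall (W : zmodType) (beta : rat -> M -> W), biadditive beta ->
    exists h : V -> W,
      [/\ zmod_morphism h, forall q m, h (q *: iota m) = beta q m
        & forall h' : V -> W, zmod_morphism h' ->
            (forall q m, h' (q *: iota m) = beta q m) -> h' =1 h].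

Lemma rationalizationP (M : zmodType) (V : lmodType rat)
    (iota : {additive M -> V}) :
  injective iota -> (forall v, exists N m, v *+ N.+1 = iota m) ->
  is_rationalization iota.
Proof.
move=> inj_i den; split.
  split=> [m q r|q m m'] /=; first by rewrite scalerBl.
  by rewrite raddfB scalerBr.
move=> W beta [betaDl betaDr].
pose bl m := GRing.isZmodMorphism.Build _ _ _ (betaDl m).
pose Bl m : {additive rat -> W} := HB.pack (beta^~ m) (bl m).
pose br q := GRing.isZmodMorphism.Build _ _ _ (betaDr q).
pose Br q : {additive M -> W} := HB.pack (beta q) (br q).
have betaMn q m n : beta (q *+ n) m = beta q (m *+ n).
  by rewrite -[LHS]/(Bl m _) -[RHS]/(Br q _) !raddfMn.
have betaMz q m n : beta (q *~ n) m = beta q (m *~ n).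
  by rewrite -[LHS]/(Bl m _) -[RHS]/(Br q _) !raddfMz.
have betaB q m n : beta q (m - n) = beta q m - beta q n.
  by rewrite -[LHS]/(Br q _) raddfB.
pose inv n : rat := n%:R^-1.
have invMn n k : (0 < k)%N -> inv (n * k)%N *+ k = inv n.
  move=> k0; rewrite /inv natrM invfM -[LHS]mulr_natr mulfVK //.
  by rewrite pnatr_eq0 -lt0n.
have invK n v : (0 < n)%N -> inv n *: (v *+ n) = v :> V.
  move=> n0; rewrite -scaler_nat scalerA mulVf ?scale1r //.
  by rewrite pnatr_eq0 -lt0n.
have /boolp.choice[nm nmP] v : exists p : nat * M,
    (0 < p.1)%N /\ v *+ p.1 = iota p.2.
  by have [n [m e]] := den v; exists (n.+1, m).
pose h v := beta (inv (nm v).1) (nm v).2.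
have hE v n m : (0 < n)%N -> v *+ n = iota m -> h v = beta (inv n) m.
  move=> n0 e; rewrite /h; have [] := nmP v.
  case: (nm v) => [n' m'] /= n'0 e'.
  have mm : m *+ n' = m' *+ n.
    by apply: inj_i; rewrite !raddfMn -e -e' -!mulrnA mulnC.
  rewrite -(invMn n' n n0) betaMn -mm -betaMn mulnC invMn //.
exists h; split.
- move=> x y; have [x0 ex] := nmP x; have [y0 ey] := nmP y.
  move: x0 y0 ex ey; rewrite {2 3}/h.
  case: (nm x) => [n m] /=; case: (nm y) => [n' m'] /= n0 n'0 ex ey.
  rewrite (hE _ (n * n')%N (m *+ n' - m' *+ n)) ?muln_gt0 ?n0 //; last first.
    rewrite raddfB !(raddfMn iota) -ex -ey -!mulrnA mulrnBl.
    by rewrite [(n' * n)%N]mulnC.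
  by rewrite betaB -!betaMn invMn // mulnC invMn.
- move=> q m; have d0 : (0 < `|denq q|)%N by rewrite absz_gt0 denq_neq0.
  rewrite (hE _ `|denq q|%N (m *~ numq q)) //.
    rewrite -betaMz /inv; congr beta.
    rewrite -{3}[q]divq_num_den -mulrzl; congr (_ / _).
    by rewrite -[in RHS](gez0_abs (denq_ge0 q)).
  rewrite raddfMz -scaler_nat scalerA -scaler_int; congr (_ *: _).
  have -> : `|denq q|%:R = (denq q)%:~R :> rat.
    by rewrite -[in RHS](gez0_abs (denq_ge0 q)).
  by rewrite numqE mulrC.
- move=> h' _ h'E v; have [n0 e] := nmP v.
  by rewrite /h -h'E -e invK.
Qed.

(* The monoid law of a conomType is written multiplicatively: the sum u + v   *)
(* of the semigroup is [mmul u v] and its neutral element 0 is [mone].        *)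
Definition affine_semigroup (S : conomType) : Prop :=
  (exists s : seq S, forall x : S, exists l : seq S,
     {subset l <= s} /\ x = \big[mmul/mone]_(u <- l) u) /\
  (exists (k : nat) (iota : S -> {ffun 'I_k -> nat}),
     [/\ injective iota, iota mone = [ffun=> 0%N] &
         forall x y, iota (mmul x y) = [ffun i => (iota x i + iota y i)%N]]).

(* Base change of quotients: if A is the rationalization of R via phi, then   *)
(* A / J is the rationalization of R / phi^-1(J).                             *)
Section IdealPreim.
Variables (R S : comPzRingType) (phi : {rmorphism R -> S}) (J : ideal S).

Definition ideal_preim_mem : {pred R} := fun x => phi x \in ideal_mem J.

Lemma ideal_preimE x : (x \in ideal_preim_mem) = (phi x \in ideal_mem J).
Proof. by []. Qed.

Fact ideal_preim_zmod_closed : zmod_closed ideal_preim_mem.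
Proof.
split=> [|x y]; rewrite !ideal_preimE ?raddf0 ?rpred0 // => xJ yJ.
by rewrite raddfB rpredB.
Qed.

Fact ideal_preim_mull a u : u \in ideal_preim_mem -> a * u \in ideal_preim_mem.
Proof. by rewrite !ideal_preimE rmorphM => uJ; apply: ideal_mull. Qed.

Definition ideal_preim : ideal R :=
  Ideal ideal_preim_zmod_closed ideal_preim_mull.

Definition quot_map (x : ringQuot ideal_preim) : ringQuot J :=
  proj J (phi (repr x)).

Lemma quot_map_proj x : quot_map (proj ideal_preim x) = proj J (phi x).
Proof.
by apply/projP; rewrite -raddfB; apply: (proj_repr ideal_preim).
Qed.

Fact quot_map_zmod_morphism : zmod_morphism quot_map.
Proof.
move=> x y; rewrite -[x]proj_reprK -[y]proj_reprK -raddfB.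
by rewrite !quot_map_proj !raddfB.
Qed.

Fact quot_map_monoid_morphism : monoid_morphism quot_map.
Proof.
split=> [|x y]; first by rewrite quot_map_proj !rmorph1.
rewrite -[x]proj_reprK -[y]proj_reprK -rmorphM.
by rewrite !quot_map_proj !rmorphM.
Qed.

HB.instance Definition _ := GRing.isZmodMorphism.Build
  (ringQuot ideal_preim) (ringQuot J) quot_map quot_map_zmod_morphism.
HB.instance Definition _ := GRing.isMonoidMorphism.Build
  (ringQuot ideal_preim) (ringQuot J) quot_map quot_map_monoid_morphism.

Lemma quot_map_inj : injective quot_map.
Proof.
move=> x y; rewrite -[x]proj_reprK -[y]proj_reprK !quot_map_proj => /projP.
by rewrite -raddfB => xyJ; apply/projP.
Qed.

End IdealPreim.

Definition clears_denominators (M V : zmodType) (iota : M -> V) : Prop :=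
  forall v, exists N m, v *+ N.+1 = iota m.

Lemma quot_map_rationalization (R : comPzRingType) (A : comAlgType rat)
    (phi : {rmorphism R -> A}) (J : ideal A) :
  clears_denominators phi -> is_rationalization (@quot_map R A phi J).
Proof.
move=> den; apply: rationalizationP; first exact: quot_map_inj.
move=> v; have [N [m e]] := den (repr v); exists N, (proj _ m).
by rewrite /= quot_map_proj -e -{1}[v]proj_reprK raddfMn.
Qed.

Lemma clears_denominators_sum (M V : zmodType) (iota : {additive M -> V})
    (I : Type) (r : seq I) (F : I -> V) :
  (forall i, exists N m, F i *+ N.+1 = iota m) ->
  exists N m, (\sum_(i <- r) F i) *+ N.+1 = iota m.
Proof.
move=> den; elim/big_ind: _ => [|x y [N [m e]] [N' [m' e']]|i _] //.
  by exists 0%N, 0; rewrite raddf0 mul0rn.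
exists (N.+1 * N'.+1).-1, (m *+ N'.+1 + m' *+ N.+1).
rewrite prednK ?muln_gt0 // mulrnDl raddfD !(raddfMn iota) -e -e' -!mulrnA.
by rewrite [(N'.+1 * _)%N]mulnC.
Qed.

Lemma rat_denom (c : rat) : exists N (a : int), c *+ N.+1 = a%:~R.
Proof.
exists `|denq c|.-1, (numq c); rewrite prednK ?absz_gt0 ?denq_neq0 //.
rewrite -mulr_natr numqE; congr (_ * _).
by rewrite -[in RHS](gez0_abs (denq_ge0 c)).
Qed.

Notation Sh S := {malg int[S]}.
Notation ShQ S := {malg rat[S]}.

Section Shift.
Variable S : conomType.

(* the map E |-> 1 (x) E from Sh to Sh_Q *)
Definition sh_rat (E : Sh S) : ShQ S :=
  \sum_(u <- monalg.msupp E) << (monalg.mcoeff u E)%:~R *g u >>.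

Definition shift_act (E : ShQ S) (h : S -> rat) (x : S) : rat :=
  \sum_(u <- monalg.msupp E) monalg.mcoeff u E * h (mmul x u).

Lemma shift_actE E h x :
  shift_act E h x = monalg.mmap idfun (fun u => h (mmul x u)) E.
Proof. by []. Qed.

Lemma shift_actB E F h x :
  shift_act (E - F) h x = shift_act E h x - shift_act F h x.
Proof. by rewrite !shift_actE raddfB. Qed.

Lemma shift_actM E F h x :
  shift_act (E * F) h x = shift_act E (shift_act F h) x.
Proof.
rewrite malgME shift_actE raddf_sum [RHS]/shift_act.
apply: eq_bigr => u _; rewrite raddf_sum mulr_sumr; apply: eq_bigr => v _.
by rewrite /= monalg.mmapU mulmA mulrA.
Qed.

Lemma mcoeff_sh_rat u E :
  monalg.mcoeff u (sh_rat E) = (monalg.mcoeff u E)%:~R.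
Proof.
rewrite [in RHS](monalgE E) /sh_rat !raddf_sum /=.
by apply: eq_bigr => v _; rewrite !mcoeffU rmorphMn.
Qed.

Fact sh_rat_is_zmod_morphism : zmod_morphism sh_rat.
Proof.
by move=> E F; apply/malgP => u; rewrite !(mcoeff_sh_rat, monalg.mcoeffB) intrB.
Qed.

HB.instance Definition _ := GRing.isZmodMorphism.Build (Sh S) (ShQ S)
  sh_rat sh_rat_is_zmod_morphism.

Lemma sh_ratU (c : int) (u : S) : sh_rat << c *g u >> = << c%:~R *g u >>.
Proof.
by apply/malgP => v; rewrite mcoeff_sh_rat !mcoeffU rmorphMn.
Qed.

Fact sh_rat_is_monoid_morphism : monoid_morphism sh_rat.
Proof.
split=> [|E F]; first exact: sh_ratU.
rewrite malgME raddf_sum [sh_rat E]/sh_rat [sh_rat F]/sh_rat mulr_suml; apply: eq_bigr => u _.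
rewrite raddf_sum mulr_sumr; apply: eq_bigr => v _.
by rewrite /= sh_ratU intrM malgM_def fgmulUU.
Qed.

HB.instance Definition _ := GRing.isMonoidMorphism.Build (Sh S) (ShQ S)
  sh_rat sh_rat_is_monoid_morphism.

End Shift.

Section ShiftAnn.
Variable S : conomType.

Lemma sh_rat_inj : injective (@sh_rat S).
Proof.
move=> E F eEF; apply/malgP => u; apply: (@intr_inj rat).
by rewrite -!mcoeff_sh_rat eEF.
Qed.

Lemma sh_rat_clears_denominators : clears_denominators (@sh_rat S).
Proof.
move=> v; rewrite (monalgE v); apply: clears_denominators_sum => u.
have [N [a e]] := rat_denom (monalg.mcoeff u v); exists N, << a *g u >>.
by rewrite /= sh_ratU -monalgUMn e.
Qed.

Lemma sh_rat_rationalization : is_rationalization (@sh_rat S).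
Proof.
exact: rationalizationP sh_rat_inj sh_rat_clears_denominators.
Qed.

Variable f : S -> rat.

Definition annShQ_mem : {pred ShQ S} :=
  fun E => `[< forall x, shift_act E f x = 0 >].

Lemma annShQP E : E \in annShQ_mem <-> forall x, shift_act E f x = 0.
Proof. by split => [/asboolP|?] //; apply/asboolP. Qed.

Fact annShQ_zmod_closed : zmod_closed annShQ_mem.
Proof.
split=> [|E F /annShQP E0 /annShQP F0]; apply/annShQP => x.
  by rewrite shift_actE raddf0.
by rewrite shift_actB E0 F0 subr0.
Qed.

Fact annShQ_mull E F : F \in annShQ_mem -> E * F \in annShQ_mem.
Proof.
move=> /annShQP F0; apply/annShQP => x.
by rewrite shift_actM /shift_act big1 // => u _; rewrite [X in _ * X]F0 mulr0.
Qed.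

Definition annShQ : ideal (ShQ S) := Ideal annShQ_zmod_closed annShQ_mull.

(* E in Sh acts through 1 (x) E *)
Definition annSh : ideal (Sh S) := ideal_preim (@sh_rat S) annShQ.

Lemma annShP (E : Sh S) :
  E \in ideal_mem annSh <-> forall x, shift_act (sh_rat E) f x = 0.
Proof. exact: annShQP. Qed.

Definition Kf : Type := ringQuot annSh.
Definition QKf : Type := ringQuot annShQ.

HB.instance Definition _ := GRing.ComPzRing.on Kf.
HB.instance Definition _ := GRing.ComPzRing.on QKf.
HB.instance Definition _ := GRing.Lmodule.on QKf.

Definition projQKf : ShQ S -> QKf := proj annShQ.

Lemma QKf_rationalization :
  is_rationalization (@quot_map _ _ (@sh_rat S) annShQ : Kf -> QKf).
Proof. exact: quot_map_rationalization sh_rat_clears_denominators. Qed.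

Definition chi (E : Sh S) : rat := shift_act (sh_rat E) f mone.

End ShiftAnn.

Record zbasis (G : zmodType) (n : nat) := ZBasis {
  zvec : 'I_n -> G;
  zdual : 'I_n -> {additive G -> int};
  zdual_vec : forall i j, zdual i (zvec j) = (i == j)%:R;
  zvec_dual : forall x, x = \sum_(i < n) zvec i *~ zdual i x
}.

(* [piece i] is the summand of degree i.+1. *)
Record graded_lattice := GradedLattice {
  lattice :> zmodType;
  max_degree : nat;
  piece : 'I_max_degree -> {pred lattice};
  piece_zmod_closed : forall i, zmod_closed (piece i);
  piece_direct : forall x : lattice, exists! c : {ffun 'I_max_degree -> lattice},
    (forall i, c i \in piece i) /\ x = \sum_i c i;
  lattice_free : exists n : nat, inhabited (zbasis lattice n)
}.

Definition homogeneous_basis (G : graded_lattice) n (b : zbasis G n) : Prop :=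
  forall j, exists i : 'I_(max_degree G), zvec b j \in piece i.

(* With n the rank and b a homogeneous basis of G, P(G) is represented by the *)
(* polynomials in the dual coordinates x_i = zdual b i, and the variables of  *)
(* Diff(G) are the partial derivatives with respect to these coordinates.     *)
Notation Pol n := {mpoly rat[n]}.
Notation Diff n := {mpoly int[n]}.
Notation DiffQ n := {mpoly rat[n]}.

Definition polfun (G : zmodType) n (b : zbasis G n) (g : Pol n) (x : G) : rat :=
  g.@[fun i => (zdual b i x)%:~R].

Section Differentiation.
Variable n : nat.

Definition diff_rat : Diff n -> DiffQ n := map_mpoly intr.

HB.instance Definition _ := GRing.RMorphism.on diff_rat.

Definition diff_act (D : DiffQ n) (g : Pol n) : Pol n :=
  \sum_(m <- msupp D) D@_m *: g^`M[m].

Lemma diff_actE D g k : (msize D <= k)%N ->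
  diff_act D g = \sum_(m : 'X_{1..n < k}) D@_m *: g^`M[m].
Proof.
move=> le_Dk; rewrite /diff_act.
set I : subFinType _ := 'X_{1..n < k}.
rewrite (big_mksub I) ?msupp_uniq //=; first last.
  by move=> x /msize_mdeg_lt /leq_trans; apply.
by rewrite big_rmcond //= => j /memN_msupp_eq0 ->; rewrite scale0r.
Qed.

Lemma diff_actB D E g : diff_act (D - E) g = diff_act D g - diff_act E g.
Proof.
pose k := maxn (msize (D - E)) (maxn (msize D) (msize E)).
rewrite !(@diff_actE _ _ k) ?leq_max ?leqnn ?orbT // -sumrB.
by apply: eq_bigr => m _; rewrite mcoeffB scalerBl.
Qed.

Lemma diff_act0 g : diff_act 0 g = 0.
Proof. by rewrite /diff_act msupp0 big_nil. Qed.

Lemma diff_actN D g : diff_act (- D) g = - diff_act D g.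
Proof. by rewrite -[- D]sub0r diff_actB diff_act0 sub0r. Qed.

Lemma diff_actD D E g : diff_act (D + E) g = diff_act D g + diff_act E g.
Proof. by rewrite -{1}[E]opprK diff_actB diff_actN opprK. Qed.

Lemma diff_actZX c m g : diff_act (c *: 'X_[m]) g = c *: g^`M[m].
Proof.
have [->|c0] := eqVneq c 0; first by rewrite !scale0r diff_act0.
rewrite /diff_act (perm_big _ (msuppZ _ c0)) msuppX big_seq1.
by rewrite mcoeffZ mcoeffX eqxx mulr1.
Qed.

Lemma diff_act_sum (I : Type) (r : seq I) (F : I -> DiffQ n) g :
  diff_act (\sum_(i <- r) F i) g = \sum_(i <- r) diff_act (F i) g.
Proof.
exact: (big_morph (diff_act^~ g) (fun D E => diff_actD D E g) (diff_act0 g)).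
Qed.

Lemma diff_actM D E g : diff_act (D * E) g = diff_act D (diff_act E g).
Proof.
rewrite mpolyME diff_act_sum big_allpairs [RHS]/diff_act.
apply: eq_bigr => m _; rewrite [diff_act E g]/diff_act linear_sum scaler_sumr.
apply: eq_bigr => m' _.
by rewrite diff_actZX /= mderivmZ scalerA addmC mderivmDm.
Qed.

Lemma diff_actr0 D : diff_act D 0 = 0.
Proof. by rewrite /diff_act big1 // => m _; rewrite linear0 scaler0. Qed.

Lemma diff_rat_inj : injective diff_rat.
Proof.
move=> D E eDE; apply/mpolyP => m; apply: (@intr_inj rat).
by rewrite -!(mcoeff_map_mpoly intr); congr mcoeff.
Qed.

Lemma diff_rat_clears_denominators : clears_denominators diff_rat.
Proof.
move=> v; rewrite (mpolyE v); apply: clears_denominators_sum => m.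
have [N [a e]] := rat_denom (v@_m); exists N, (a *: 'X_[m]).
by rewrite /= /diff_rat map_mpolyZ map_mpolyX /= -e scalerMnl.
Qed.

Lemma diff_rat_rationalization : is_rationalization diff_rat.
Proof.
exact: rationalizationP diff_rat_inj diff_rat_clears_denominators.
Qed.

Variable g : Pol n.

Definition annDiffQ_mem : {pred DiffQ n} := fun D => diff_act D g == 0.

Lemma annDiffQP D : reflect (diff_act D g = 0) (D \in annDiffQ_mem).
Proof. exact: eqP. Qed.

Fact annDiffQ_zmod_closed : zmod_closed annDiffQ_mem.
Proof.
split=> [|D E /annDiffQP D0 /annDiffQP E0]; apply/annDiffQP.
  exact: diff_act0.
by rewrite diff_actB D0 E0 subr0.
Qed.

Fact annDiffQ_mull D E : E \in annDiffQ_mem -> D * E \in annDiffQ_mem.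
Proof.
by move=> /annDiffQP E0; apply/annDiffQP; rewrite diff_actM E0 diff_actr0.
Qed.

Definition annDiffQ : ideal (DiffQ n) :=
  Ideal annDiffQ_zmod_closed annDiffQ_mull.

(* D in Diff acts through 1 (x) D *)
Definition annDiff : ideal (Diff n) := ideal_preim diff_rat annDiffQ.

Lemma annDiffP (D : Diff n) :
  reflect (diff_act (diff_rat D) g = 0) (D \in ideal_mem annDiff).
Proof. exact: annDiffQP. Qed.

Definition Ag : Type := ringQuot annDiff.
Definition QAg : Type := ringQuot annDiffQ.

HB.instance Definition _ := GRing.ComPzRing.on Ag.
HB.instance Definition _ := GRing.ComPzRing.on QAg.
HB.instance Definition _ := GRing.Lmodule.on QAg.

Lemma QAg_rationalization :
  is_rationalization (@quot_map _ _ diff_rat annDiffQ : Ag -> QAg).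
Proof. exact: quot_map_rationalization diff_rat_clears_denominators. Qed.

End Differentiation.

Section Degree.
Variables (G : zmodType) (n : nat) (b : zbasis G n) (g : Pol n).

(* The choice of representative is irrelevant by deg_proj; deg_Ag shows that  *)
(* deg extends deg_g linearly from Ag.                                        *)
Definition deg (x : QAg g) : rat := polfun b (diff_act (repr x) g) 0.

Lemma deg_proj (D : DiffQ n) :
  deg (proj (annDiffQ g) D) = polfun b (diff_act D g) 0.
Proof.
have /annDiffQP := proj_repr (annDiffQ g) D.
by rewrite diff_actB /deg => /eqP; rewrite subr_eq0 => /eqP->.
Qed.

Lemma deg_Ag (D : Diff n) :
  deg (quot_map (proj (annDiff g) D)) = polfun b (diff_act (diff_rat D) g) 0.
Proof. by rewrite quot_map_proj deg_proj. Qed.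

Fact deg_zmod_morphism : zmod_morphism deg.
Proof.
move=> x y; rewrite -[x]proj_reprK -[y]proj_reprK -raddfB !deg_proj.
by rewrite diff_actB /polfun mevalB.
Qed.

HB.instance Definition _ := GRing.isZmodMorphism.Build (QAg g) rat deg
  deg_zmod_morphism.

End Degree.

(* GRing.unit is not available: QAg g is the zero ring when g = 0. *)
Definition invertible (R : pzRingType) (x : R) : Prop :=
  exists y, x * y = 1 /\ y * x = 1.

(* phi factors through the canonical projection onto QKf f, and the induced   *)
(* map is an isomorphism of Q-algebras.                                       *)
Definition descends_to_iso (S : conomType) (f : S -> rat) n (g : Pol n)
    (phi : ShQ S -> QAg g) : Prop :=
  exists psi : {rmorphism QKf f -> QAg g},
    [/\ forall E, phi E = psi (projQKf f E), scalable psi & bijective psi].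

(* Main.v *)
(** Call two linear forms on a commutative algebra equivalent if they have the
    same radical, i.e. the same largest ideal in their kernels.  Over a field,
    if the algebra is finite-dimensional modulo the radical of [l], then every
    form vanishing on that radical is of the shape [x |-> l (t * x)]; for two
    equivalent forms the two multipliers are mutually inverse modulo the
    radical.  On [ShQ S], the form [chi_f] has radical [Ann f], while
    [deg_g o phi] has radical [ker phi], because a polynomial all of whose
    derivatives vanish at 0 is zero.  Finally, [phi] descends to an isomorphism
    exactly when [ker phi = Ann f]. *)
Require Import Defs.
From HB Require Import structures.
From mathcomp Require Import all_boot all_order all_algebra.
From mathcomp Require boolp.
From mathcomp Require Import monalg mpoly.

Set Implicit Arguments.
Unset Strict Implicit.
Unset Printing Implicit Defensive.

Import GRing.Theory.
Local Open Scope ring_scope.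

Section Radical.
Variables (F : fieldType) (A : comAlgType F).

Definition in_radical (l : A -> F) (x : A) : Prop := forall y, l (x * y) = 0.

Definition spans_mod_radical (l : A -> F) (I : finType) (a : I -> A) : Prop :=
  forall x, exists c : I -> F, in_radical l (x - \sum_i c i *: a i).

(** The multiplier solves a linear system whose matrix is the Gram matrix of [l] on the family. That
    matrix may be singular, so solvability has to come from the inclusion of radicals. *)
Lemma scalar_form_represented (I : finType) (a : I -> A) (l m : {scalar A}) :
  spans_mod_radical l a ->
  (forall x, in_radical l x -> in_radical m x) ->
  exists t, forall x, m x = l (t * x).
Proof.
move=> span rad.
pose e (i : 'I_#|I|) := a (enum_val i).
have spane x : exists c : 'I_#|I| -> F, in_radical l (x - \sum_i c i *: e i).
  have [c cP] := span x; exists (c \o enum_val) => y; rewrite -[RHS](cP y).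
  by rewrite [in RHS](reindex _ (onW_bij _ (enum_val_bij _))).
pose L : 'M[F]_#|I| := \matrix_(i, j) l (e i * e j).
pose r : 'rV[F]_#|I| := \row_j m (e j).
(* r lies in the row space of L, as it is killed by the column kernel of L. *)
have [w wE] : exists w, r = w *m L.
  apply/submxP; rewrite submxE; apply/eqP/rowP => k; rewrite !mxE.
  pose v j := cokermx L j k; pose x := \sum_j v j *: e j.
  have lex i : l (e i * x) = 0.
    have /matrixP/(_ i k) := mulmx_coker L; rewrite !mxE => E.
    rewrite -[RHS]E mulr_sumr linear_sum; apply: eq_bigr => j _.
    by rewrite -scalerAr linearZ /= mxE mulrC.
  (* [x] is [l]-orthogonal to every [e i], and these span modulo the radical. *)
  have xrad : in_radical l x.
    move=> y; have [c cP] := spane y; have := cP x.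
    rewrite mulrBl linearB /= mulrC => /subr0_eq ->.
    rewrite mulr_suml linear_sum big1 // => i _.
    by rewrite -scalerAl linearZ /= lex mulr0.
  have := rad _ xrad 1; rewrite mulr1 linear_sum /= => E; rewrite -[RHS]E.
  by apply: eq_bigr => j _; rewrite linearZ /= mxE mulrC.
pose t := \sum_i w 0 i *: e i.
exists t => x; have [c cP] := spane x.
(* Both [l (t * x)] and [m x] depend only on [x] modulo the radical of [l], so [x] may be replaced
   by a combination of the [e j]. *)
have := cP t; rewrite mulrC mulrBr linearB /= => /subr0_eq ->.
have := rad _ cP 1; rewrite mulr1 linearB /= => /subr0_eq ->.
rewrite mulr_sumr !linear_sum; apply: eq_bigr => j _.
rewrite -scalerAr !linearZ /=; congr (_ * _).
have /rowP/(_ j) := wE; rewrite !mxE => ->.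
rewrite mulr_suml linear_sum; apply: eq_bigr => i _.
by rewrite mxE -scalerAl linearZ.
Qed.

(** Representing each form by the other gives [l x = m (s * x) = l (t * s * x)]. *)
Lemma scalar_form_twist (I : finType) (a : I -> A) (l m : {scalar A}) :
  spans_mod_radical l a ->
  (forall x, in_radical l x <-> in_radical m x) ->
  exists t s, (forall x, m x = l (t * x)) /\ in_radical l (t * s - 1).
Proof.
move=> span rad.
have [t tP] : exists t, forall x, m x = l (t * x).
  by apply: scalar_form_represented span _ => x /rad.
have [s sP] : exists s, forall x, l x = m (s * x).
  apply: (@scalar_form_represented _ a) => [x|x /rad//].
  by have [c /rad cP] := span x; exists c.
exists t, s; split=> // x.
by rewrite mulrBl mul1r linearB /= -mulrA -tP -sP subrr.
Qed.

End Radical.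

Section ShiftForm.
Variables (S : conomType) (f : S -> rat).

Definition chiQ (E : ShQ S) : rat := shift_act E f mone.

Fact chiQ_is_scalar : scalar chiQ.
Proof.
move=> c E E'; rewrite /chiQ !shift_actE raddfD /=; congr (_ + _).
rewrite -shift_actE -mul_malgC shift_actM [LHS]shift_actE.
by rewrite monalg.mmapU mulm1.
Qed.

HB.instance Definition _ :=
  GRing.isLinear.Build rat (ShQ S) rat *%R chiQ chiQ_is_scalar.

(** Multiplying by [<< x >>] moves the point of evaluation from the neutral element to [x]. *)
Lemma in_radical_chiQ (E : ShQ S) :
  in_radical chiQ E <-> E \in ideal_mem (annShQ f).
Proof.
split=> [E0|/annShQP E0 E']; last first.
  rewrite /chiQ mulrC shift_actM /shift_act big1 // => u _.
  by rewrite [X in _ * X]E0 mulr0.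
apply/annShQP => x; have := E0 << x >>; rewrite /chiQ mulrC shift_actM.
by rewrite shift_actE monalg.mmapU mul1r mul1m.
Qed.

End ShiftForm.

Section DegreeForm.
Variables (G : zmodType) (n : nat) (b : zbasis G n) (g : Pol n).

(** All coordinates vanish at the origin; [deg] thus becomes the extraction of a constant
    coefficient. *)
Lemma polfun0 (p : Pol n) : polfun b p 0 = p@_0.
Proof.
rewrite /polfun mevalE [in RHS](mpolyE p) raddf_sum.
apply: eq_bigr => m _; rewrite /= mcoeffZ mcoeffX; congr (_ * _).
have [->|/eqP m0] := eqVneq m 0%MM.
  by rewrite big1 // => i _; rewrite mnm0E expr0.
have [i mi] : exists i, m i != 0%N.
  apply/existsP; apply: contraPT m0; rewrite negb_exists => /forallP m0.
  by apply; apply/mnmP => i; have /negPn/eqP-> := m0 i; rewrite mnm0E.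
by rewrite (bigD1 i) //= raddf0 expr0n (negbTE mi) mul0r.
Qed.

Lemma deg_scalable (c : rat) (x : QAg g) : deg b (c *: x) = c * deg b x.
Proof.
rewrite -[x]proj_reprK -linearZ /= !deg_proj !polfun0.
rewrite -[repr x in LHS]mul1r -mpolyX0 scalerAl diff_actM diff_actZX.
by rewrite mderivm0m mcoeffZ.
Qed.

(** Testing [x] against ['X_[m]] yields the coefficient at [m] of [diff_act (repr x) g] times the
    product of the factorials of the [m i], which is nonzero in characteristic 0. *)
Lemma deg_nondegenerate (x : QAg g) : (forall y, deg b (x * y) = 0) -> x = 0.
Proof.
rewrite -[x]proj_reprK => x0; apply/proj_eq0/annDiffQP/mpolyP => m.
have := x0 (proj (annDiffQ g) 'X_[m]); rewrite mulrC -rmorphM /= deg_proj.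
rewrite diff_actM -['X_[m]]scale1r diff_actZX scale1r polfun0 mcoeff_mderivm.
rewrite addm0 mcoeff0 => /eqP; rewrite Num.Theory.mulrn_eq0 => /orP[|/eqP//].
rewrite eqn0Ngt prodn_gt0 // => i.
by rewrite ffactnn fact_gt0.
Qed.

(** Derivatives of order at least [msize g] kill [g], so a representative may be truncated. *)
Lemma QAg_span (x : QAg g) : exists c : 'X_{1..n < msize g} -> rat,
  x = \sum_m c m *: proj (annDiffQ g) 'X_[m].
Proof.
pose D := repr x; exists (fun m => D@_m).
rewrite -[x]proj_reprK -/D.
have -> : \sum_(m : 'X_{1..n < msize g}) D@_m *: proj (annDiffQ g) 'X_[m]
        = proj (annDiffQ g) (\sum_(m : 'X_{1..n < msize g}) D@_m *: 'X_[m]).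
  by rewrite raddf_sum; apply: eq_bigr => m _; rewrite /= linearZ.
apply/projP/annDiffQP; rewrite /diff_act big1 // => m _.
have [lt_mg|le_gm] := ltnP (mdeg m) (msize g).
  by rewrite mcoeffB (mcoeff_mpoly (fun m => D@_m)) // subrr scale0r.
rewrite (_ : g^`M[m] = 0) ?scaler0 //; apply/mpolyP => m'.
rewrite mcoeff_mderivm memN_msupp_eq0 ?mul0rn ?mcoeff0 //.
apply: contraTN le_gm => /msize_mdeg_lt; rewrite mdegD -ltnNge.
by apply: leq_ltn_trans; rewrite leq_addr.
Qed.

End DegreeForm.

Section DegreePullback.
Variables (S : conomType) (G : zmodType) (n : nat) (b : zbasis G n) (g : Pol n).
Variable phi : {lrmorphism ShQ S -> QAg g}.
Hypothesis phi_surj : forall y : QAg g, exists E : ShQ S, phi E = y.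

Definition deg_phi (E : ShQ S) : rat := deg b (phi E).

Fact deg_phi_is_scalar : scalar deg_phi.
Proof. by move=> c E E'; rewrite /deg_phi linearP raddfD /= deg_scalable. Qed.

HB.instance Definition _ :=
  GRing.isLinear.Build rat (ShQ S) rat *%R deg_phi deg_phi_is_scalar.

Lemma in_radical_deg_phi (E : ShQ S) :
  in_radical deg_phi E <-> phi E = 0.
Proof.
split=> [E0|E0 E']; last by rewrite /deg_phi rmorphM /= E0 mul0r raddf0.
apply: (deg_nondegenerate (b := b)) => y; have [E' <-] := phi_surj y.
by rewrite -rmorphM; apply: E0.
Qed.

Lemma deg_phi_span : exists a : 'X_{1..n < msize g} -> ShQ S,
  spans_mod_radical deg_phi a.
Proof.
have /fin_all_exists[a aP] (m : 'X_{1..n < msize g}) :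
  exists E : ShQ S, phi E = proj (annDiffQ g) 'X_[m] by exact: phi_surj.
exists a => x; have [c cP] := QAg_span (phi x); exists c.
apply/in_radical_deg_phi; rewrite raddfB /= linear_sum cP.
by apply/eqP; rewrite subr_eq0; apply/eqP/eq_bigr => m _; rewrite linearZ /= aP.
Qed.

End DegreePullback.

Lemma descends_to_isoP (S : conomType) (f : S -> rat) n (g : Pol n)
    (phi : {lrmorphism ShQ S -> QAg g})
    (phi_surj : forall y : QAg g, exists E : ShQ S, phi E = y) :
  descends_to_iso f phi <->
  forall E, phi E = 0 <-> E \in ideal_mem (annShQ f).
Proof.
split=> [[psi [psiE _ psi_bij]] E|kerE].
  rewrite psiE -proj_eq0 -/(projQKf f E); split=> [|->]; last exact: raddf0.
  by rewrite -[RHS](raddf0 psi) => /(bij_inj psi_bij).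
(* Independent of the representative because [Ann f] lies in [ker phi]. *)
pose psi (x : QKf f) : QAg g := phi (repr x).
have psiE E : psi (projQKf f E) = phi E.
  by apply/subr0_eq; rewrite -raddfB; apply/kerE/proj_repr.
have psiB : zmod_morphism psi.
  move=> x y; rewrite -[x]proj_reprK -[y]proj_reprK -raddfB.
  by rewrite !psiE raddfB.
have psiM : monoid_morphism psi.
  split=> [|x y]; first by rewrite -[1]/(projQKf f 1) psiE rmorph1.
  rewrite -[x]proj_reprK -[y]proj_reprK -rmorphM.
  by rewrite !psiE rmorphM.
pose psi_add := GRing.isZmodMorphism.Build _ _ psi psiB.
pose psi_mul := GRing.isMonoidMorphism.Build _ _ psi psiM.
pose Psi : {rmorphism QKf f -> QAg g} := HB.pack psi psi_add psi_mul.
exists Psi; split=> [E|c x|]; first by rewrite /= psiE.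
  by rewrite -[x]proj_reprK -linearZ /= !psiE linearZ.
(* A section of [phi] induces the inverse; it is a left inverse because [ker phi] lies in
   [Ann f]. *)
have /boolp.choice[h hE] := phi_surj.
exists (projQKf f \o h) => [x|y] /=; last by rewrite psiE.
rewrite -[RHS]proj_reprK; apply/projP/kerE.
by rewrite raddfB /= hE subrr.
Qed.

(** Some positive multiple of [E] is integral, and [rat] is torsion-free. *)
Lemma chi_eqQ (S : conomType) (f : S -> rat) (l : {additive ShQ S -> rat}) :
  (forall E : Sh S, chi f E = l (sh_rat E)) -> forall E, chiQ f E = l E.
Proof.
move=> chiE E; have [N [E' e]] := sh_rat_clears_denominators E.
have : chiQ f E *+ N.+1 = l E *+ N.+1 by rewrite -!raddfMn e -chiE.
by move/(Num.Theory.pmulrnI (ltn0Sn N)).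
Qed.

Unset Implicit Arguments.

Theorem theorem2p21 (S : conomType) (hS : affine_semigroup S)
  (G : graded_lattice) (n : nat) (b : zbasis G n) (hb : homogeneous_basis b)
  (g : Pol n)
  (phi : {lrmorphism ShQ S -> QAg g})
  (phi_surj : forall y : QAg g, exists E : ShQ S, phi E = y)
  (f : S -> rat) :
  descends_to_iso f phi <->
  exists td : QAg g, invertible td /\
    forall E : Sh S, chi f E = deg b (td * phi (sh_rat E)).
Proof.
rewrite descends_to_isoP //; split=> [kerE|[td [[u [tdK _]] chiE]] E].
  have [a aP] := deg_phi_span b phi_surj.
  have [|t [s [tP /in_radical_deg_phi tsP]]] :=
    scalar_form_twist (m := chiQ f) aP.
    by move=> E; rewrite in_radical_deg_phi // in_radical_chiQ.
  (* [t * s - 1] lies in the radical of [deg_phi], which is [ker phi], so [phi s] inverts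
     [phi t]. *)
  exists (phi t); split=> [|E]; last by rewrite -rmorphM; apply: tP.
  have /subr0_eq : phi t * phi s - 1 = 0.
    by have := tsP phi_surj; rewrite rmorphB rmorphM rmorph1.
  by exists (phi s); split; last rewrite mulrC.
have [t phit] := phi_surj td.
have chiQE E' : chiQ f E' = deg_phi b phi (t * E').
  pose l : {additive ShQ S -> rat} := deg_phi b phi \o (t \*o idfun).
  apply: (@chi_eqQ _ f l) => E''.
  by rewrite chiE -phit -rmorphM.
rewrite -(in_radical_deg_phi b phi_surj) -in_radical_chiQ.
split=> E0 E'; first by rewrite chiQE mulrCA E0.
(* [u'] lifts the inverse of [td], so inserting [t * u'] leaves [deg_phi] unchanged and turns it
   into a value of [chiQ f] on a multiple of [E]. *)
have [u' phiu] := phi_surj u.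
have -> : deg_phi b phi (E * E') = deg_phi b phi (t * (E * (u' * E'))).
  rewrite /deg_phi !rmorphM /= phit phiu; congr deg.
  by rewrite mulrCA [td * (u * _)]mulrA tdK mul1r.
by rewrite -chiQE E0.
Qed.
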